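(* Consider a system that maps arrival functions to departure functions, and let $(A,D)$ be a pair consisting of an arrival function $A$ and the corresponding departure function $D$ of the system. Assume that the difference $\mathcal{L}_D(r)-\mathcal{L}_A(r)$ is defined for all $r\ge 0$, i.e. there is no $r\ge0$ with $\mathcal{L}_D(r)=\mathcal{L}_A(r)=\infty$ (a sufficient condition is $\mathcal{L}_A(r)<\infty$ for all $r\ge 0$). (i) If $\underline{S}$ is a lower service curve of the system, i.e. $D'\ge A'*\underline{S}$ for all pairs $(A',D')$ of arrival and departure functions of the system, then $\mathcal{L}_{\underline{S}}\ge \mathcal{L}_D-\mathcal{L}_A$ and hence $\mathcal{L}(\mathcal{L}_{\underline{S}})\le \mathcal{L}(\mathcal{L}_D-\mathcal{L}_A)$. (ii) Suppose the system is min-plus linear with exact service curve $S$, i.e. $D'=A'*S$ for all pairs $(A',D')$ of arrival and departure functions of the system. Put $\tilde S=\mathcal{L}(\mathcal{L}_D-\mathcal{L}_A)$. Then $\tilde S=\mathcal{L}(\mathcal{L}_S)$ and $\tilde S\le S$; consequently $\tilde S$ is a lower service curve, i.e. $D'\ge A'*\tilde S$ for every such pair $(A',D')$. (iii) If, in the situation of (ii), $S$ is also convex, then $S=\mathcal{L}(\mathcal{L}_D-\mathcal{L}_A)=\tilde S$, so the service curve is recovered exactly.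
   Context: Arrival functions, departure functions and the service curves $\underline{S}$ and $S$ are non-decreasing functions $[0,\infty)\to[0,\infty]$ that vanish at $0$. For functions $f,g:[0,\infty)\to[0,\infty]$, the min-plus convolution is $(f*g)(t)=\inf_{0\le\tau\le t}\{f(\tau)+g(t-\tau)\}$ for $t\ge 0$. The Legendre transform of an extended-real-valued function $f$ on $[0,\infty)$ is $\mathcal{L}_f(r)=\mathcal{L}(f)(r)=\sup_{\tau\ge 0}\{r\tau-f(\tau)\}$ for $r\ge 0$, with $x-\infty=-\infty$ and $x-(-\infty)=+\infty$ for finite $x$. It is applied both to functions of time $t\ge0$ (giving functions of rate $r\ge0$) and to functions of rate (giving functions of time). Inequalities and equalities between functions are pointwise on $[0,\infty)$.
   Formalization: In (iii), S is also assumed left-continuous at the right end of the set where it is finite (vacuous for finite S); without this (iii) fails, e.g. S=0 on [0,1), ∞ on [1,∞). The parenthetical sufficient condition for definedness is not stated. *)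

(* Defs.v *)
From HB Require Import structures.
From mathcomp Require Import all_boot all_order all_algebra.
From mathcomp Require Import all_classical all_reals all_analysis.

Set Implicit Arguments.
Unset Strict Implicit.
Unset Printing Implicit Defensive.

Import Order.TTheory GRing.Theory Num.Theory.
Import numFieldNormedType.Exports.

Local Open Scope classical_set_scope.
Local Open Scope ring_scope.
Local Open Scope ereal_scope.

(* A function on [0, oo) is represented by a function on R; only its values
   at nonnegative points are ever constrained or used. *)

Definition fle (R : realType) (f g : R -> \bar R) : Prop :=
  forall t : R, (0 <= t)%R -> f t <= g t.

Definition feq (R : realType) (f g : R -> \bar R) : Prop :=
  forall t : R, (0 <= t)%R -> f t = g t.

(* Non-decreasing functions [0, oo) -> [0, oo] vanishing at 0. *)
Definition curve (R : realType) (f : R -> \bar R) : Prop :=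
  [/\ f 0%R = 0,
      (forall t : R, (0 <= t)%R -> 0 <= f t)
    & (forall s t : R, (0 <= s)%R -> (s <= t)%R -> f s <= f t)].

Definition minplus_conv (R : realType) (f g : R -> \bar R) (t : R) : \bar R :=
  ereal_inf [set f tau + g (t - tau)%R | tau in `[0%R, t]].

(* Subtracting from a finite number, x - +oo = -oo and x - -oo = +oo. *)
Definition legendre (R : realType) (f : R -> \bar R) (r : R) : \bar R :=
  ereal_sup [set (r * tau)%:E - f tau | tau in `[0%R, +oo[].

(* A system assigns a departure function to every arrival function. *)
Definition is_system (R : realType)
    (Phi : (R -> \bar R) -> (R -> \bar R)) : Prop :=
  forall A, curve A -> curve (Phi A).

Definition lower_service_curve (R : realType)
    (Phi : (R -> \bar R) -> (R -> \bar R)) (S : R -> \bar R) : Prop :=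
  curve S /\ forall A, curve A -> fle (minplus_conv A S) (Phi A).

Definition exact_service_curve (R : realType)
    (Phi : (R -> \bar R) -> (R -> \bar R)) (S : R -> \bar R) : Prop :=
  curve S /\ forall A, curve A -> feq (Phi A) (minplus_conv A S).

(* Here 0 * +oo = 0, so the cases l = 0 and l = 1 are trivial. *)
Definition convex_curve (R : realType) (S : R -> \bar R) : Prop :=
  forall x y l : R, (0 <= x)%R -> (0 <= y)%R -> (0 <= l <= 1)%R ->
    S (l * x + (1 - l) * y)%R <= l%:E * S x + (1 - l)%:E * S y.

(* Left-continuity at the right end of the set where S is finite (above that
   end it holds trivially).  It is vacuous for finite-valued S, and cannot be
   dropped for extended-valued ones: with S = 0 on [0, 1) and S = +oo on
   [1, +oo), S is convex, but legendre (legendre S) 1 = 0. *)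
Definition left_continuous_at_end (R : realType) (S : R -> \bar R) : Prop :=
  forall t : R, (0 < t)%R -> (forall u : R, (t < u)%R -> S u = +oo) ->
    S x @[x --> t^'-] --> S t.

(* Main.v *)
Require Import Defs.
From HB Require Import structures.
From mathcomp Require Import all_boot all_order all_algebra.
From mathcomp Require Import all_classical all_reals all_analysis.
From mathcomp Require Import ring lra.

Import Order.TTheory GRing.Theory Num.Theory.
Import numFieldNormedType.Exports.

(** The Legendre transform is antitone and turns min-plus convolution of curves
    into addition.  Hence D >= A * S gives L_D <= L_A + L_S, and D = A * S gives
    L_D - L_A = L_S, since finiteness of L_A r is forced by the hypothesis that
    L_D r and L_A r are not both infinite.  The biconjugate of a curve S is a
    curve below S.  If S is convex, t > 0 and 0 <= c < S t, then S s >= c for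
    some s < t, and an affine function of nonnegative slope taking the value c
    at t lies below S, so that c is below the biconjugate at t. *)

Local Open Scope classical_set_scope.
Local Open Scope ring_scope.
Local Open Scope ereal_scope.

(** * Order properties of the Legendre transform *)

Section LegendreTransform.
Context {R : realType}.
Implicit Types (f g : R -> \bar R) (r t tau : R).

Lemma legendre_lbound f r tau : (0 <= tau)%R ->
  (r * tau)%:E - f tau <= legendre f r.
Proof.
move=> tau0; apply: ereal_sup_ubound; exists tau => //.
by rewrite /= in_itv /= tau0.
Qed.

Lemma legendre_le f r (M : \bar R) :
  (forall tau, (0 <= tau)%R -> (r * tau)%:E - f tau <= M) -> legendre f r <= M.
Proof.
move=> H; apply: ge_ereal_sup => _ [tau /= + <-].
by rewrite in_itv /= andbT => /H.
Qed.

Lemma legendre_antitone f g : fle f g -> forall r, legendre g r <= legendre f r.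
Proof.
move=> fg r; apply: legendre_le => tau tau0.
apply: le_trans (legendre_lbound f r _ tau0).
by rewrite leeD2l// leeN2 fg.
Qed.

(** The supremum only sees nonnegative arguments, so agreement there yields equal transforms as
    functions on all of [R], ready for rewriting under an outer transform. *)
Lemma legendre_ext f g : feq f g -> legendre f = legendre g.
Proof.
move=> fg; apply/funext => r; apply/eqP; rewrite eq_le.
by apply/andP; split; apply: legendre_antitone => t t0; rewrite fg.
Qed.

Lemma legendre_ge0 f r : f 0%R = 0 -> 0 <= legendre f r.
Proof.
by move=> f0; have := legendre_lbound f r 0 (lexx _); rewrite f0 mulr0 sube0.
Qed.

Lemma legendre_at0 f : f 0%R = 0 -> (forall t, (0 <= t)%R -> 0 <= f t) ->
  legendre f 0 = 0.
Proof.
move=> f0 fge0; apply/eqP; rewrite eq_le legendre_ge0// andbT.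
by apply: legendre_le => t t0; rewrite mul0r sub0e leeNl oppe0 fge0.
Qed.

Lemma legendre_fin_num {f r} (M : R) : f 0%R = 0 -> legendre f r <= M%:E ->
  legendre f r \is a fin_num.
Proof.
move=> f0 fM; rewrite ge0_fin_numE ?legendre_ge0//.
by rewrite (le_lt_trans fM) ?ltry.
Qed.

(** * Min-plus convolution and its transform *)

Lemma minplus_conv_le f g t tau : (0 <= tau <= t)%R ->
  minplus_conv f g t <= f tau + g (t - tau)%R.
Proof.
by move=> tau0t; apply: ereal_inf_lbound; exists tau; rewrite //= in_itv.
Qed.

Lemma minplus_conv_ge f g t (M : \bar R) :
  (forall tau, (0 <= tau <= t)%R -> M <= f tau + g (t - tau)%R) ->
  M <= minplus_conv f g t.
Proof.
move=> H; apply: le_ereal_inf_tmp => _ [tau /= + <-].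
by rewrite in_itv /= => /H.
Qed.

Lemma minplus_conv_mono f g h : fle g h ->
  fle (minplus_conv f g) (minplus_conv f h).
Proof.
move=> gh t t0; apply: minplus_conv_ge => tau /andP[tau0 taut].
apply: le_trans (minplus_conv_le f g _ tau _) _; first by rewrite tau0.
by rewrite leeD2l// gh// subr_ge0.
Qed.

Lemma legendre_conv f g r : curve f -> curve g ->
  legendre (minplus_conv f g) r = legendre f r + legendre g r.
Proof.
move=> [f0 fge0 _] [g0 gge0 _].
have Lf0 := legendre_ge0 f r f0; have Lg0 := legendre_ge0 g r g0.
apply/eqP; rewrite eq_le; apply/andP; split.
- have [->|] := eqVneq (legendre f r + legendre g r) +oo; first by rewrite leey.
  rewrite -ltey -ge0_fin_numE ?adde_ge0// fin_numD => /andP[Lffin Lgfin].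
  apply: legendre_le => t t0.
  (* Split [r * t] as [r * tau + r * (t - tau)] and bound each piece by the transform of its own
     function. *)
  have key : (r * t)%:E - (legendre f r + legendre g r) <= minplus_conv f g t.
    apply: minplus_conv_ge => tau /andP[tau0 taut].
    have := legendre_lbound f r _ tau0.
    have : (0 <= t - tau)%R by rewrite subr_ge0.
    move=> /[dup] /gge0 + /(legendre_lbound g r); move: (fge0 _ tau0).
    move: (legendre f r) (legendre g r) Lffin Lgfin => [a| |] [b| |] // _ _.
    case: (f tau) (g (t - tau)%R) => [x| |] [y| |] //= _ _;
      rewrite ?addey ?leey//.
    by rewrite -!(EFinN, EFinD) !lee_fin; lra.
  move: Lffin Lgfin key.
  move: (legendre f r) (legendre g r) => [a| |] [b| |] // _ _.
  case: (minplus_conv f g t) => [x| |] //=; rewrite ?addeNy ?leNye//.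
  by rewrite -!(EFinN, EFinD) !lee_fin; lra.
(* The times [a] and [b] are one admissible splitting of [a + b], so the pair is dominated by the
   term at [a + b]. *)
- have key a b : (0 <= a)%R -> (0 <= b)%R ->
      (r * a)%:E - f a + ((r * b)%:E - g b) <= legendre (minplus_conv f g) r.
    move=> a0 b0.
    apply: le_trans (legendre_lbound _ r (a + b)%R (addr_ge0 a0 b0)).
    have := minplus_conv_le f g (a + b)%R a; rewrite a0 lerDl b0 => /(_ isT).
    rewrite addrAC subrr add0r; move: (fge0 _ a0) (gge0 _ b0).
    case: (f a) (g b) (minplus_conv f g _) => [x| |] [y| |] [z| |] //=;
      rewrite ?addNye ?addeNy ?leNye ?leey//.
    by rewrite -!(EFinN, EFinD) !lee_fin; lra.
  move: key; case: (legendre (minplus_conv f g) r) => [L| |] key.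
  (* The joint supremum over [a] and [b] is taken one variable at a time, first over [a] with [b]
     fixed. *)
  + have stepf a b : (0 <= a)%R -> (0 <= b)%R -> g b \is a fin_num ->
        (r * a)%:E - f a <= L%:E - ((r * b)%:E - g b).
      move=> a0 b0 gb; move: (key _ _ a0 b0) (fge0 _ a0) gb.
      case: (f a) (g b) => [x| |] [y| |] //=; rewrite ?addeNy ?leNye//.
      by rewrite -!(EFinN, EFinD) !lee_fin; lra.
    (* Taking [b = 0], where [g] vanishes, bounds [legendre f r] by [L]. *)
    have Lffin : legendre f r \is a fin_num.
      apply: (legendre_fin_num L f0); apply: legendre_le => a a0.
      by have := stepf a 0%R a0 (lexx _); rewrite g0 mulr0 !sube0; apply.
    have : legendre g r <= L%:E - legendre f r.
      apply: legendre_le => b b0.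
      have [gb|] := boolP (g b \is a fin_num); last first.
        by move: (gge0 _ b0); case: (g b) => //= _; rewrite addeNy leNye.
      have := legendre_le f r _ (fun a a0 => stepf a b a0 b0 gb).
      move: Lffin gb; case: (legendre f r) (g b) => [x| |] [y| |] //= _ _.
      by rewrite -!(EFinN, EFinD) !lee_fin; lra.
    by rewrite leeBrDr// addeC.
  + by rewrite leey.
  + by have := key 0%R 0%R (lexx _) (lexx _); rewrite f0 g0 mulr0 !sube0 adde0.
Qed.

(** * The biconjugate *)

Lemma legendre2_le f : (forall t, (0 <= t)%R -> 0 <= f t) ->
  fle (legendre (legendre f)) f.
Proof.
move=> fge0 t t0; apply: legendre_le => r r0.
have := legendre_lbound f r _ t0; move: (fge0 _ t0).
case: (legendre f r) (f t) => [x| |] [y| |] //= _;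
  rewrite ?leey ?addeNy ?leNye//.
by rewrite -!(EFinN, EFinD) !lee_fin; lra.
Qed.

(** A lower service curve has to be a curve, so this is required of the recovered [S']. Monotonicity
    comes from the slopes [r] being nonnegative. *)
Lemma legendre2_curve f : f 0%R = 0 -> (forall t, (0 <= t)%R -> 0 <= f t) ->
  curve (legendre (legendre f)).
Proof.
move=> f0 fge0; have Lf0 := legendre_at0 f f0 fge0.
split => [|t _|s t _ st].
- by rewrite legendre_at0// => r _; exact: legendre_ge0.
- exact: legendre_ge0.
- apply: legendre_le => r r0; apply: le_trans (legendre_lbound _ t _ r0).
  by rewrite leeD2r// lee_fin ler_wpM2r.
Qed.

(** Such a minorant forces [legendre f r] to be at most [r * t - c], so the term of slope [r] in the
    outer supremum at [t] is already at least [c]. *)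
Lemma affine_minorant_le_legendre2 f (r t c : R) : (0 <= r)%R ->
  (forall tau, (0 <= tau)%R -> (c + r * (tau - t))%:E <= f tau) ->
  c%:E <= legendre (legendre f) t.
Proof.
move=> r0 H; apply: le_trans (legendre_lbound _ t _ r0).
have : legendre f r <= (r * t - c)%:E.
  apply: legendre_le => tau /H.
  case: (f tau) => [x| |] //=; rewrite ?leNye//.
  by rewrite -!(EFinN, EFinD) !lee_fin; lra.
case: (legendre f r) => [x| |] //=; rewrite ?leey//.
by rewrite -!(EFinN, EFinD) !lee_fin; lra.
Qed.

End LegendreTransform.

(** * Convex curves and their affine minorants *)

Section ConvexBiconjugate.
Context {R : realType} {S : R -> \bar R}.
Hypotheses (curveS : curve S) (convS : convex_curve S)
  (lcS : left_continuous_at_end S).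

Let S0 : S 0%R = 0. Proof. by case: curveS. Qed.
Let Sge0 (t : R) : (0 <= t)%R -> 0 <= S t.
Proof. by case: curveS => _ + _; exact. Qed.
Let Smono (s t : R) : (0 <= s)%R -> (s <= t)%R -> S s <= S t.
Proof. by case: curveS => _ _; exact. Qed.

(** This is the chord inequality with its denominator [z - x] cleared, a form suited to linear
    arithmetic. *)
Lemma convex_three_points (x y z a b c : R) :
  (0 <= x)%R -> (x < y)%R -> (y < z)%R ->
  S x = a%:E -> S y = b%:E -> S z = c%:E ->
  ((z - x) * b <= (z - y) * a + (y - x) * c)%R.
Proof.
move=> x0 xy yz Sx Sy Sz.
have zx : (0 < z - x)%R by lra.
have z0 : (0 <= z)%R by lra.
pose l := ((z - y) / (z - x))%R.
have l01 : (0 <= l <= 1)%R.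
  by rewrite divr_ge0 ?ler_pdivrMr //=; lra.
have -> : ((z - y) * a + (y - x) * c = (z - x) * (l * a + (1 - l) * c))%R.
  by rewrite /l; field; lra.
rewrite ler_pM2l//; have := convS x z l x0 z0 l01.
have -> : (l * x + (1 - l) * z = y)%R by rewrite /l; field; lra.
by rewrite Sx Sy Sz -!EFinM -EFinD lee_fin.
Qed.

(** [S] cannot jump upwards on reaching [t]. If [S] is infinite beyond [t], this is the
    left-continuity hypothesis; otherwise a finite value at some [u > t] lets convexity rule out the
    jump. *)
Lemma convex_left_approx (t c : R) : (0 < t)%R -> c%:E < S t ->
  exists s, [/\ (0 <= s)%R, (s < t)%R & c%:E <= S s].
Proof.
move=> t0 cSt.
have [allinf|] := pselect (forall u, (t < u)%R -> S u = +oo).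
  have Sc : \forall x \near t^'-, c%:E < S x.
    exact: (lcS t t0 allinf _ (open_ereal_gt_ereal cSt)).
  have xpos : \forall x \near t^'-, (0 < x)%R by exact: nbhs_left_gt.
  have [s [[cs s0] st]] :=
    @filter_ex _ _ (at_left_proper_filter t) _
      (filterI (filterI Sc xpos) (nbhs_left_lt t)).
  by exists s; split; rewrite ?ltW.
move=> /existsNP[u /not_implyP[tu Suoo]].
have u0 : (0 <= u)%R by lra.
have Stu := Smono _ _ (ltW t0) (ltW tu).
case Su : (S u) Suoo Stu (Sge0 _ u0) => [v| |] // _ Stu _.
case St : (S t) cSt Stu (Sge0 _ (ltW t0)) => [y| |] // cy yv _.
rewrite lte_fin in cy; rewrite lee_fin in yv.
(* [e] is chosen so that, if S (t - e) < c, the chord from t - e to u passes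
   below (t, S t), against convexity. *)
have wp : (0 < (u - t) * (y - c))%R by apply: mulr_gt0; lra.
have tq : (0 < t * (v - c))%R by apply: mulr_gt0; lra.
(* Since [d] is at least [(u - t) * (y - c)], [e <= t]; since [d] exceeds [t * (v - c)],
   [e * (v - c) < (u - t) * (y - c)]. *)
pose d := (t * (v - c) + (u - t) * (y - c))%R.
have d0 : (0 < d)%R by rewrite /d; lra.
pose e := (t * ((u - t) * (y - c)) / d)%R.
have e0 : (0 < e)%R by rewrite divr_gt0// mulr_gt0.
have et : (e <= t)%R by rewrite ler_pdivrMr// ler_pM2l// /d; lra.
have eq : (e * (v - c) < (u - t) * (y - c))%R.
  rewrite /e mulrAC ltr_pdivrMr// /d.
  by have := mulr_gt0 wp wp; lra.
have s0 : (0 <= t - e)%R by lra.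
have st : (t - e < t)%R by lra.
exists (t - e)%R; split => //.
case Ss : (S (t - e)%R) (Sge0 _ s0) => [x| |] // _; last by rewrite leey.
rewrite lee_fin leNgt; apply/negP => xc.
have := convex_three_points _ _ _ _ _ _ s0 st tu Ss St Su.
have : ((u - t) * x <= (u - t) * c)%R by rewrite ler_pM2l; lra.
have : (0 < e * (y - c))%R by rewrite mulr_gt0//; lra.
by lra.
Qed.

(* Inside [s, t] monotonicity makes any nonnegative slope work, so only the
   points outside of [s, t] constrain the slope r; the chord slope works. *)
Lemma convex_affine_minorant (t c : R) :
  (0 < t)%R -> (0 <= c)%R -> c%:E < S t ->
  exists2 r, (0 <= r)%R &
    forall tau, (0 <= tau)%R -> (c + r * (tau - t))%:E <= S tau.
Proof.
move=> t0 c0 cSt; have [s [s0 st cSs]] := convex_left_approx t c t0 cSt.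
have ts : (0 < t - s)%R by lra.
have inside r tau : (0 <= r)%R -> (s <= tau)%R -> (tau <= t)%R ->
    (c + r * (tau - t))%:E <= S tau.
  move=> r0 stau taut; apply: le_trans (Smono _ _ s0 stau).
  apply: le_trans cSs; rewrite lee_fin gerDl mulr_ge0_le0//; lra.
case St : (S t) cSt (Sge0 _ (ltW t0)) => [y| |] // cy _; last first.
  (* Here [S] is infinite from [t] on. This slope makes the affine function vanish at [s], hence
     nonpositive before [s]. *)
  exists (c / (t - s))%R; first by rewrite divr_ge0// ltW.
  move=> tau tau0; have [ttau|taut] := leP t tau.
    move: (Smono _ _ (ltW t0) ttau).
    by rewrite St leye_eq => /eqP ->; rewrite leey.
  have [stau|taus] := leP s tau.
    by apply: inside => //; [rewrite divr_ge0// ltW|exact: ltW].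
  apply: le_trans (Sge0 _ tau0); rewrite lee_fin.
  have -> : c = (c / (t - s) * (t - s))%R by field; lra.
  rewrite mulfK ?gt_eqF// -mulrDr mulr_ge0_le0//; last by lra.
  by rewrite divr_ge0// ltW.
rewrite lte_fin in cy.
have := Smono _ _ s0 (ltW st); rewrite St.
case Ss : (S s) (Sge0 _ s0) => [x| |] // _; rewrite lee_fin => xy.
pose r := ((y - x) / (t - s))%R.
have r0 : (0 <= r)%R by rewrite divr_ge0; lra.
have yE : (y = x + r * (t - s))%R by rewrite /r; field; lra.
(* Outside of [[s, t]] the graph of [S] lies above the extended chord, which has height [y > c] at
   [t]. *)
exists r => // tau tau0; have [taut|ttau] := leP tau t.
  have [stau|taus] := leP s tau; first exact: inside.
  have := Smono _ _ tau0 taut; rewrite St.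
  case Stau : (S tau) (Sge0 _ tau0) => [z| |] // _ _.
  have := convex_three_points _ _ _ _ _ _ tau0 taus st Stau Ss St.
  rewrite lee_fin => chord.
  have : ((t - s) * (x + r * (tau - s)) <= (t - s) * z)%R.
    by move: chord; rewrite yE; lra.
  by rewrite ler_pM2l// => ?; lra.
case Stau : (S tau) (Sge0 _ tau0) => [z| |] // _; last by rewrite leey.
have := convex_three_points _ _ _ _ _ _ s0 st ttau Ss St Stau.
rewrite lee_fin => chord.
have : ((t - s) * (y + r * (tau - t)) <= (t - s) * z)%R.
  by move: chord; rewrite yE; lra.
by rewrite ler_pM2l// => ?; lra.
Qed.

(** Choosing [c] strictly below [S t] avoids supporting lines at [t] itself: at the right end of the
    domain [S t] may be infinite, or the slopes unbounded. *)
Lemma convex_le_legendre2 : fle S (legendre (legendre S)).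
Proof.
have [LL0 LLge0 _] := legendre2_curve S S0 Sge0.
move=> t; rewrite le_eqVlt => /predU1P[<-|t0]; first by rewrite S0 LL0.
rewrite leNgt; apply/negP => LLS.
have LLfin : legendre (legendre S) t \is a fin_num.
  by rewrite ge0_fin_numE ?LLge0 ?ltW// (lt_le_trans LLS) ?leey.
have [c /andP[LLc cS]] : exists c : R, legendre (legendre S) t < c%:E < S t.
  move: LLS LLfin; case: (legendre _ t) (S t) => [a| |] [b| |] // ab _.
    exists ((a + b) / 2)%R; move: ab; rewrite !lte_fin => ab.
    by apply/andP; split; lra.
  by exists (a + 1)%R; rewrite lte_fin ltrDl ltr01 ltry.
have c0 : (0 <= c)%R.
  by rewrite -lee_fin ltW// (le_lt_trans _ LLc)// LLge0// ltW.
have [r r0 /(affine_minorant_le_legendre2 _ _ _ _ r0)] :=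
  convex_affine_minorant t c t0 c0 cS.
by rewrite leNgt LLc.
Qed.

End ConvexBiconjugate.

Theorem mainTheorem4 (R : realType)
  (Phi : (R -> \bar R) -> (R -> \bar R)) (hPhi : is_system Phi)
  (A D : R -> \bar R) (hA : curve A) (hD : D = Phi A)
  (hdef : forall r : R, (0 <= r)%R ->
     ~ (legendre D r = +oo /\ legendre A r = +oo)) :
  (* (i) *)
  (forall S : R -> \bar R, lower_service_curve Phi S ->
     fle (legendre D \- legendre A) (legendre S) /\
     fle (legendre (legendre S)) (legendre (legendre D \- legendre A)))
  /\
  (* (ii) and (iii) *)
  (forall S : R -> \bar R, exact_service_curve Phi S ->
     let S' := legendre (legendre D \- legendre A) in
     [/\ feq S' (legendre (legendre S)),
         fle S' S,
         lower_service_curve Phi S'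
       & (convex_curve S -> left_continuous_at_end S -> feq S S')]).
Proof.
subst D; have [A0 _ _] := hA; have [D0 _ _] := hPhi A hA.
split=> [S [curveS lowS]|S [curveS exS] S'].
- have LDLA : fle (legendre (Phi A) \- legendre A) (legendre S).
    move=> r r0 /=; have := legendre_antitone _ _ (lowS A hA) r.
    rewrite legendre_conv//; have := hdef r r0.
    have [S0 _ _] := curveS.
    have := legendre_ge0 _ r D0; have := legendre_ge0 S r S0.
    have := legendre_ge0 A r A0.
    case: (legendre (Phi A) r) (legendre A r) (legendre S r)
      => [d| |] [a| |] [s| |] //= _ _ _ nn; rewrite ?leNye ?leey//.
    by rewrite -!(EFinN, EFinD) !lee_fin; lra.
  by split=> // t _; exact: legendre_antitone.
- have [S0 Sge0 _] := curveS.
  have LDLA : feq (legendre (Phi A) \- legendre A) (legendre S).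
    move=> r r0 /=; have := hdef r r0.
    rewrite (legendre_ext _ _ (exS A hA)) legendre_conv//.
    have := legendre_ge0 S r S0; have := legendre_ge0 A r A0.
    (* An infinite [legendre A r] would make its sum with the nonnegative [legendre S r] infinite
       too, against [nn]; a finite one cancels. *)
    case: (legendre A r) (legendre S r) => [a| |] [s| |] //= _ _ nn;
      try by case: nn.
    by rewrite -!(EFinN, EFinD); congr EFin; lra.
  have -> : S' = legendre (legendre S) by exact: legendre_ext.
  have LLS := legendre2_le S Sge0.
  split=> //; first split.
  + exact: legendre2_curve.
  + by move=> B hB t t0; rewrite exS//; exact: minplus_conv_mono.
  + move=> convS lcS t t0; apply/eqP; rewrite eq_le LLS// andbT.
    exact: convex_le_legendre2.
Qed.
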